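(* Let $M\in\mathbb{R}^{n\times n}$ and $M'\in\mathbb{R}^{n'\times n'}$ be irreducible nonnegative matrices such that $M'\mathbf{1}_{n'}=\rho'\mathbf{1}_{n'}$ for some $\rho'\in\mathbb{R}$. Let $\operatorname{spec}(M)=\{\rho(M)=\lambda_1,\lambda_2,\dots,\lambda_n\}$ and $\operatorname{spec}(M')=\{\rho',\lambda'_2,\dots,\lambda'_{n'}\}$. Then $$\operatorname{spec}(M\otimes\mathbb{J}_{n'}+\mathbb{I}_n\otimes M')=\{n'\lambda_i+\rho' : i=1,\dots,n\}\cup\{{\lambda'_j}^{(n)} : j=2,\dots,n'\}.$$
   Context: $\mathbf{1}_n$ is the all-ones vector, $\mathbb{J}_n$ the $n\times n$ all-ones matrix, $\mathbb{I}_n$ the identity matrix, $\otimes$ the Kronecker product, and $\rho(M)$ the spectral radius of $M$. $\operatorname{spec}(A)$ is the multiset of complex eigenvalues of $A$ with algebraic multiplicity; $x^{(m)}$ means $x$ is listed $m$ times, and unions are unions of multisets (multiplicities add). *)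

(* Defs.v *)
From HB Require Import structures.
From mathcomp Require Import all_boot all_order all_fingroup all_algebra.
From mathcomp Require Import finmap multiset.
From mathcomp Require Import reals complex mxtens.

Set Implicit Arguments.
Unset Strict Implicit.
Unset Printing Implicit Defensive.

Import Order.TTheory GRing.Theory Num.Theory.
Import ComplexField.

Local Open Scope ring_scope.
Local Open Scope complex_scope.
Local Open Scope mset_scope.

(* [closed_field_poly_normal p] is a list of the roots of [p], each repeated
   according to its multiplicity. *)
Definition spec (R : realType) (n : nat) (A : 'M[R]_n) : {mset R[i]} :=
  seq_mset (sval (closed_field_poly_normal
    (char_poly (map_mx (real_complex R) A)))).

Definition spectral_radius (R : realType) (n : nat) (A : 'M[R]_n) : R :=
  \big[Num.max/0]_(z <- spec A) Normc.normc z.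

Definition nonnegative_mx (R : realType) (m n : nat) (A : 'M[R]_(m, n)) :=
  forall i j, 0 <= A i j.

(* [A] is permutation similar to a block upper triangular matrix with square
   diagonal blocks of sizes [r] and [n - r], both nonempty.  Every 1 x 1 matrix,
   including 0, is thus irreducible. *)
Definition reducible_mx (R : realType) (n : nat) (A : 'M[R]_n) :=
  exists (s : 'S_n) (r : nat), (0 < r < n)%N /\
    forall i j : 'I_n, (j < r <= i)%N ->
      (perm_mx s *m A *m (perm_mx s)^T) i j = 0.

Definition irreducible_mx (R : realType) (n : nat) (A : 'M[R]_n) :=
  ~ reducible_mx A.

Lemma char_poly_spec (R : realType) (n : nat) (A : 'M[R]_n) :
  char_poly (map_mx (real_complex R) A) = \prod_(z <- spec A) ('X - z%:P).
Proof.
rewrite /spec; case: closed_field_poly_normal => s /= Es.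
rewrite (perm_big _ (perm_eq_seq_mset s)) Es.
by rewrite (monicP (char_poly_monic _)) scale1r.
Qed.

Lemma spec_mup (R : realType) (n : nat) (A : 'M[R]_n) (z : R[i]) :
  spec A z = mup z (char_poly (map_mx (real_complex R) A)).
Proof.
rewrite /spec; case: closed_field_poly_normal => s /= Es.
rewrite Es (monicP (char_poly_monic _)) scale1r mset_seqE.
by rewrite mu_prod_XsubC.
Qed.

(* Main.v *)
Require Import Defs.
From mathcomp Require Import all_boot all_order all_fingroup all_algebra.
From mathcomp Require Import finmap multiset.
From mathcomp Require Import reals complex mxtens.

Set Implicit Arguments.
Unset Strict Implicit.
Unset Printing Implicit Defensive.

Import Order.TTheory GRing.Theory Num.Theory.

Local Open Scope ring_scope.
Local Open Scope complex_scope.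
Local Open Scope mset_scope.

(** Write [1] for the all-ones column, [J = 1 1^T], and [B] for [M'].  Since
    [B 1 = rho' 1], also [(x I - B) J = a J] with [a = x - rho'], and this makes
    the characteristic matrix factor up to the scalar [a]:
      [(I (x) (x I - B)) (a I - M (x) J) = a (x I - M (x) J - I (x) B)].
    The first factor has determinant [det (x I - B) ^ n] ([det_tens1mx]).  In the
    second, [M (x) J = (M (x) 1) (I (x) 1^T)], and the Sylvester identity
    [det_scalar_sub_mulmxC] exchanges the two factors, whose product in the other
    order is [n' M].  Taking determinants and cancelling powers of [a] gives
    ([det_tens_rank1])
      [a^n chi(x) = det (x I - B) ^ n det (a I - n' M)],
    with [chi] the characteristic polynomial of the matrix of the theorem.
    As [det (x I - B)] is [a] times the product of the [x - lambda'_j], one more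
    cancellation of [a^n] leaves [n] copies of each [x - lambda'_j], and
    [det (a I - n' M)] is the product of the [x - rho' - n' lambda_i].
    The identity is used with [x] the indeterminate of a polynomial ring, where
    [a] is nonzero even if [rho'] is an eigenvalue of the large matrix. *)

(** * Determinants of Kronecker products *)

Lemma tensmxBr (D : comPzRingType) m n p q (A : 'M[D]_(m, n))
    (B C : 'M[D]_(p, q)) : A *t (B - C) = A *t B - A *t C.
Proof. by apply/matrixP=> i j; rewrite !mxE mulrBr. Qed.

Lemma tens1_scalar_mx (D : comPzRingType) n p (c : D) :
  (1%:M : 'M_n) *t (c%:M : 'M_p) = c%:M.
Proof.
apply/matrixP => i j.
case: (mxtens_indexP i) => i1 i2; case: (mxtens_indexP j) => j1 j2.
rewrite tensmxE !mxE (can_eq (@mxtens_indexK n p)) xpair_eqE.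
by case: eqP => _; case: eqP => _; rewrite /= ?mulr0n ?mulr1n ?mul0r ?mul1r.
Qed.

(** [I_(n+1) (x) B] is block diagonal with blocks [B] and [I_n (x) B], the type
    ['M_(n.+1 * p)] being convertible to ['M_(p + n * p)]. *)
Lemma det_tens1mx (D : comPzRingType) n p (B : 'M[D]_p) :
  \det ((1%:M : 'M_n) *t B) = \det B ^+ n.
Proof.
elim: n => [|n IHn]; first by rewrite det_mx00.
suff -> : (1%:M : 'M_n.+1) *t B
    = block_mx B 0 0 ((1%:M : 'M_n) *t B) :> 'M_(p + n * p).
  by rewrite det_ublock IHn exprS.
have unindexl (k : 'I_p) :
    mxtens_unindex (lshift (n * p) k : 'I_(n.+1 * p)) = (ord0, k).
  by congr pair; apply: val_inj; rewrite /= ?divn_small ?modn_small.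
have unindexr (k : 'I_(n * p)) :
    mxtens_unindex (rshift p k : 'I_(n.+1 * p))
    = (lift ord0 (mxtens_unindex k).1, (mxtens_unindex k).2).
  have p_gt0 : (0 < p)%N.
    by case: p k {B IHn unindexl} => // -[k]; rewrite muln0.
  congr pair; apply: val_inj; rewrite /= ?modnDl //.
  by rewrite divnDl // divnn p_gt0.
apply/matrixP => i j; rewrite mxE.
case: (split_ordP (i : 'I_(p + n * p))) => {}i ->;
case: (split_ordP (j : 'I_(p + n * p))) => {}j ->;
rewrite ?(block_mxEul, block_mxEur, block_mxEdl, block_mxEdr);
rewrite ?unindexl ?unindexr !mxE /=.
- by rewrite mulr1n mul1r.
- by rewrite mulr0n mul0r.
- by rewrite mulr0n mul0r.
- by rewrite (inj_eq lift_inj).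
Qed.

(** Sylvester's identity, in a form that needs neither inverses nor a
    comparison of [m] and [n]: both sides come from clearing a corner of the
    same block matrix [P], once by columns and once by rows. *)
Lemma det_scalar_sub_mulmxC (D : comPzRingType) m n (a : D)
    (A : 'M[D]_(m, n)) (B : 'M[D]_(n, m)) :
  a ^+ n * \det (a%:M - A *m B) = a ^+ m * \det (a%:M - B *m A).
Proof.
pose P := block_mx a%:M A B 1%:M.
have detP : \det P = \det (a%:M - A *m B).
  have : P *m block_mx 1%:M 0 (- B) 1%:M = block_mx (a%:M - A *m B) A 0 1%:M.
    rewrite mulmx_block !mulmx1 !mulmx0 !mulmxN !mul1mx.
    by rewrite !add0r subrr.
  move/(congr1 determinant).
  by rewrite det_mulmx det_lblock det_ublock !det1 !mulr1.
have : block_mx 1%:M 0 (- B) a%:M *m P = block_mx a%:M A 0 (a%:M - B *m A).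
  rewrite mulmx_block !mulmx1 !mul0mx !mul1mx !mulNmx.
  by rewrite !addr0 scalar_mxC addNr (addrC (- _)).
move/(congr1 determinant).
by rewrite det_mulmx det_lblock det_ublock det1 !det_scalar mul1r detP.
Qed.

(** The matrix on the left has size [n * 1], which is not convertible to [n]. *)
Lemma det_scalar_sub_tens_scalar (D : comPzRingType) n (a c : D) (A : 'M[D]_n) :
  \det (a%:M - A *t (c%:M : 'M_1)) = \det (a%:M - c *: A).
Proof.
rewrite tens_mx_scalar; move: (esym (muln1 n)); move: (n * 1)%N => k e.
by case: k / e; rewrite castmx_id.
Qed.

(** For [u] an eigenvector of [B], the rank-one matrix [u v] satisfies
    [(t - B) u v = (t - r) u v], so that [I (x) (t - B)] splits off and leaves a
    scalar matrix minus [(A (x) u) (I (x) v)], to which Sylvester's identity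
    applies. *)
Lemma det_tens_rank1 (D : idomainType) n p (A : 'M[D]_n) (B : 'M[D]_p)
    (u : 'cV[D]_p) (v : 'rV[D]_p) (r c t : D) :
    B *m u = r *: u -> v *m u = c%:M -> t - r != 0 ->
  (t - r) ^+ n * \det (t%:M - (A *t (u *m v) + (1%:M : 'M_n) *t B))
  = \det (t%:M - B) ^+ n * \det ((t - r)%:M - c *: A).
Proof.
set a := t - r => Bu vu a_neq0; set K := A *t (u *m v).
have tBu : (t%:M - B) *m (u *m v) = a *: (u *m v).
  by rewrite mulmxA mulmxBl Bu mul_scalar_mx -scalerBl scalemxAl.
have factor : ((1%:M : 'M_n) *t (t%:M - B)) *m (a%:M - K)
    = a *: (t%:M - (K + (1%:M : 'M_n) *t B)).
  rewrite mulmxBr tensmx_mul mul1mx tBu mul_mx_scalar tensmxBr tens1_scalar_mx.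
  have -> : A *t (a *: (u *m v)) = a *: K.
    by apply/matrixP => i j; rewrite !mxE mulrCA.
  by rewrite -scalerBr opprD addrA [t%:M - _ - _]addrAC.
have := det_scalar_sub_mulmxC a (A *t u) ((1%:M : 'M_n) *t v).
rewrite !tensmx_mul mulmx1 mul1mx vu det_scalar_sub_tens_scalar muln1 -/K.
move=> sylvester; move/(congr1 determinant): factor.
rewrite det_mulmx detZ det_tens1mx => factor.
(* Both determinant identities carry the surplus factor [a ^ (n * p)]. *)
apply: (mulfI (expf_neq0 (n * p) a_neq0)).
by rewrite mulrCA -factor mulrCA sylvester mulrCA.
Qed.

(** * From determinants to spectra *)

(** The matrix is [c] times the characteristic matrix of [A] with
    [(X - r) / c] substituted for [X]; each of the [n = size s] factors of
    the characteristic polynomial then absorbs one [c]. *)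
Lemma char_poly_scale_shift (F : fieldType) n (A : 'M[F]_n) (s : seq F) (c r : F) :
    c != 0 -> char_poly A = \prod_(z <- s) ('X - z%:P) ->
  \det (('X - r%:P)%:M - c%:P *: map_mx polyC A)
  = \prod_(z <- s) ('X - (c * z + r)%:P).
Proof.
move=> c_neq0 charA.
have size_s : size s = n.
  by apply: succn_inj; rewrite -(size_char_poly A) charA size_prod_XsubC.
have cK : c%:P * c^-1%:P = 1 :> {poly F} by rewrite -polyCM mulfV.
pose q : {poly F} := c^-1%:P * ('X - r%:P).
have -> : ('X - r%:P)%:M - c%:P *: map_mx polyC A
    = c%:P *: map_mx (comp_poly q) (char_poly_mx A).
  apply/matrixP => i j; rewrite !mxE rmorphB rmorphMn /= comp_polyX comp_polyC.
  by rewrite mulrBr -mulrnAr mulrA cK mul1r.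
rewrite detZ det_map_mx -/(char_poly A) charA rmorph_prod /= -size_s.
have -> : c%:P ^+ size s = \prod_(z <- s) c%:P :> {poly F}.
  by rewrite big_const_seq count_predT iter_mulr_1.
rewrite -big_split /=; apply: eq_bigr => z _.
rewrite rmorphB /= comp_polyX comp_polyC mulrBr mulrA cK mul1r.
by rewrite polyCD polyCM opprD addrAC addrA.
Qed.

Lemma spec_seq_mset (R : realType) n (A : 'M[R]_n) (s : seq R[i]) :
  char_poly (map_mx (real_complex R) A) = \prod_(z <- s) ('X - z%:P) ->
  spec A = seq_mset s.
Proof.
move=> charA; apply/msetP => z.
by rewrite spec_mup charA mu_prod_XsubC mset_seqE.
Qed.

Lemma char_poly_spec_seq (R : realType) n (A : 'M[R]_n) (s : seq R[i]) :
  spec A = seq_mset s ->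
  char_poly (map_mx (real_complex R) A) = \prod_(z <- s) ('X - z%:P).
Proof. by rewrite char_poly_spec => ->; apply/perm_big/perm_eq_seq_mset. Qed.

Theorem theorem3p3 (R : realType) (n n' : nat) (hn : (0 < n)%N) (hn' : (0 < n')%N)
    (M : 'M[R]_n) (M' : 'M[R]_n') (rho' : R) (lambda lambda' : nat -> R[i])
    (M_irr : irreducible_mx M) (M_ge0 : nonnegative_mx M)
    (M'_irr : irreducible_mx M') (M'_ge0 : nonnegative_mx M')
    (M'_rowsum : M' *m (const_mx 1 : 'cV[R]_n') = rho' *: (const_mx 1 : 'cV[R]_n'))
    (lambda1 : lambda 1%N = (spectral_radius M)%:C)
    (spec_M : spec M = seq_mset [seq lambda i | i <- index_iota 1 n.+1])
    (spec_M' : spec M' =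
       [mset rho'%:C] `+` seq_mset [seq lambda' j | j <- index_iota 2 n'.+1]) :
  spec (M *t (const_mx 1 : 'M[R]_n') + (1%:M : 'M[R]_n) *t M') =
    seq_mset [seq n'%:R * lambda i + rho'%:C | i <- index_iota 1 n.+1]
    `+` \big[msetD/mset0]_(2 <= j < n'.+1) msetn n (lambda' j).
Proof.
(* It suffices to list the right-hand side as a sequence: equality of spectra
   is then a factorization of the characteristic polynomial. *)
set sM := index_iota 1 n.+1; set sM' := index_iota 2 n'.+1.
pose s' := flatten [seq nseq n (lambda' j) | j <- sM'].
transitivity
  (seq_mset ([seq n'%:R * lambda i + rho'%:C | i <- sM] ++ s')); last first.
  apply/msetP => z; rewrite msetE2 !mset_seqE count_cat; congr addn.
  rewrite count_flatten sumnE !big_map.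
  elim/big_ind2: _ => [|? A ? B -> ->|j _]; rewrite ?mset0E ?msetE2 //.
  by rewrite count_nseq msetnE /= eq_sym; case: eqP; rewrite ?mul1n ?mul0n.
apply: spec_seq_mset; rewrite big_cat big_flatten /=.
pose h : {rmorphism R -> {poly R[i]}} := polyC \o real_complex R.
pose u : 'cV[{poly R[i]}]_n' := const_mx 1.
have hu : map_mx h M' *m u = h rho' *: u.
  have -> : u = map_mx h (const_mx 1) by rewrite map_const_mx rmorph1.
  by rewrite -map_mxM M'_rowsum map_mxZ.
have huu : u^T *m u = (n'%:R)%:M.
  apply/matrixP => i j; rewrite !ord1 !mxE eqxx mulr1n.
  under eq_bigr => k _ do rewrite !mxE mulr1.
  by rewrite sumr_const card_ord.
have X_neq : 'X - h rho' != 0 by apply/monic_neq0/monicXsubC.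
have := det_tens_rank1 (map_mx h M) hu huu X_neq.
have charM' := char_poly_spec_seq (n := n') (A := M')
   (s := rho'%:C :: [seq lambda' j | j <- sM']).
rewrite mset_cons in charM'; move/(_ spec_M'): charM'.
rewrite big_cons big_map => charM'.
have charM := char_poly_spec_seq spec_M.
have n'_neq0 : n'%:R != 0 :> R[i] by rewrite pnatr_eq0 -lt0n.
have -> : 'X%:M - map_mx h M' = char_poly_mx (map_mx (real_complex R) M').
  by rewrite /char_poly_mx -map_mx_comp.
rewrite -/(char_poly _) charM' exprMn -mulrA.
(* The eigenvalue [rho'] of [M'], raised to the power [n], cancels here. *)
move/(mulfI (expf_neq0 n X_neq)).
have -> : 'X%:M - (map_mx h M *t (u *m u^T) + 1%:M *t map_mx h M')
  = char_poly_mx (map_mx (real_complex R) (M *t const_mx 1 + 1%:M *t M')).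
  rewrite /char_poly_mx -map_mx_comp map_mxD !map_mxT map_mx1.
  congr (_ - (_ *t _ + _)).
  by apply/matrixP => i j; rewrite !mxE big_ord1 !mxE mulr1 -[RHS]/(h 1) rmorph1.
rewrite -/(char_poly _) => ->.
have := char_poly_scale_shift rho'%:C n'_neq0 charM.
rewrite -map_mx_comp rmorph_nat big_map => ->.
rewrite mulrC !big_map; congr (_ * _).
rewrite -prodrXl; apply: eq_bigr => j _.
by rewrite big_nseq iter_mulr_1.
Qed.
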